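(* Let $(X,\phi)$ be a flow on a compact metric space $(X,d)$. Then $$\mathrm{mdim}(X,\phi)\le \underline{\mathrm{mdim}}_M(\phi,X,d)\le \overline{\mathrm{mdim}}_M(\phi,X,d).$$
   Context: A flow is a pair $(X,\phi)$ where $(X,d)$ is a compact metric space and $\phi:X\times\mathbb{R}\to X$ is continuous, with $\phi_t(x):=\phi(x,t)$ satisfying $\phi_0=\mathrm{id}$ and $\phi_{t+s}=\phi_t\circ\phi_s$ for all $s,t\in\mathbb{R}$. For $t>0$ let $d_t(x,y)=\max_{s\in[0,t]}d(\phi_s x,\phi_s y)$. For $Z\subset X$, $t>0$, $\epsilon>0$, let $r_t(\phi,Z,d,\epsilon)$ be the minimal cardinality of a set $E\subset X$ such that for every $x\in Z$ there is $y\in E$ with $d_t(x,y)<\epsilon$, and $r(\phi,Z,d,\epsilon)=\limsup_{t\to\infty}\frac1t\log r_t(\phi,Z,d,\epsilon)$. The upper and lower metric mean dimensions are $\overline{\mathrm{mdim}}_M(\phi,X,d)=\limsup_{\epsilon\to0}\frac{r(\phi,X,d,\epsilon)}{\log(1/\epsilon)}$ and $\underline{\mathrm{mdim}}_M(\phi,X,d)=\liminf_{\epsilon\to0}\frac{r(\phi,X,d,\epsilon)}{\log(1/\epsilon)}$. For a compact metric space $(X,\rho)$ and $\epsilon>0$, a continuous map $f:X\to K$ into a compact metric space $K$ is a $(\rho,\epsilon)$-embedding if $f(x)=f(y)$ implies $\rho(x,y)<\epsilon$; $\mathrm{Wdim}_\epsilon(X,\rho)$ is the minimum of the Lebesgue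 covering dimension $\dim K$ over all compact metric spaces $K$ admitting a $(\rho,\epsilon)$-embedding $X\to K$. The mean dimension of the flow is $\mathrm{mdim}(X,\phi)=\lim_{\epsilon\to0}\lim_{t\to\infty}\frac{\mathrm{Wdim}_\epsilon(X,d_t)}{t}$ (the limits exist). *)

(* Defs.v *)
From Stdlib Require List.
From mathcomp Require Import all_boot all_order all_algebra.
From mathcomp Require Import all_classical all_reals all_analysis.
Set Implicit Arguments. Unset Strict Implicit. Unset Printing Implicit Defensive.
Import Order.TTheory GRing.Theory Num.Def Num.Theory.
Import numFieldNormedType.Exports.
Local Open Scope classical_set_scope.
Local Open Scope ring_scope.

Section Defs.
Variable R : realType.

Definition is_metric (X : Type) (d : X -> X -> R) : Prop :=
  [/\ (forall x y, 0 <= d x y),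
      (forall x y, d x y = 0 <-> x = y),
      (forall x y, d x y = d y x) &
      (forall x y z, d x z <= d x y + d y z)].

Definition mopen (X : Type) (d : X -> X -> R) (A : set X) : Prop :=
  forall x, A x -> exists2 r : R, 0 < r & forall y, d x y < r -> A y.

Definition mcompact (X : Type) (d : X -> X -> R) : Prop :=
  forall (I : Type) (U : I -> set X),
    (forall i, mopen d (U i)) -> (forall x, exists i, U i x) ->
    exists s : seq I, forall x, exists i, List.In i s /\ U i x.

Definition mcontinuous (X Y : Type) (dX : X -> X -> R) (dY : Y -> Y -> R)
  (f : X -> Y) : Prop :=
  forall x (e : R), 0 < e -> exists2 delta : R, 0 < delta &
    forall y, dX x y < delta -> dY (f x) (f y) < e.

Definition is_flow (X : Type) (d : X -> X -> R) (phi : X -> R -> X) : Prop :=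
  [/\ (forall x t (e : R), 0 < e -> exists2 delta : R, 0 < delta &
         forall y s, d x y < delta -> `|t - s| < delta ->
           d (phi x t) (phi y s) < e),
      (forall x, phi x 0 = x) &
      (forall x s t, phi x (t + s) = phi (phi x s) t)].

Definition dflow (X : Type) (d : X -> X -> R) (phi : X -> R -> X) (t : R)
  (x y : X) : R :=
  sup [set d (phi x s) (phi y s) | s in `[0, t]].

Local Open Scope ereal_scope.

Definition span_num (X : Type) (d : X -> X -> R) (phi : X -> R -> X)
  (Z : set X) (t eps : R) : \bar R :=
  ereal_inf [set (n%:R)%:E | n in
    [set n : nat | exists E : 'I_n -> X,
       forall x, Z x -> exists j, (dflow d phi t x (E j) < eps)%R]].

Definition span_rate (X : Type) (d : X -> X -> R) (phi : X -> R -> X)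
  (Z : set X) (eps : R) : \bar R :=
  limf_esup (fun t : R => (t^-1)%:E * lne (span_num d phi Z t eps))
    (pinfty_nbhs R).

Definition upper_mmdim (X : Type) (d : X -> X -> R) (phi : X -> R -> X) : \bar R :=
  limf_esup (fun eps : R => span_rate d phi setT eps * ((ln (eps^-1))^-1)%:E)
    (0%R)^'+.

Definition lower_mmdim (X : Type) (d : X -> X -> R) (phi : X -> R -> X) : \bar R :=
  limf_einf (fun eps : R => span_rate d phi setT eps * ((ln (eps^-1))^-1)%:E)
    (0%R)^'+.

Definition covdim_le (K : Type) (dK : K -> K -> R) (n : nat) : Prop :=
  forall U : seq (set K),
    (forall A, List.In A U -> mopen dK A) ->
    (forall x, exists A, List.In A U /\ A x) ->
    exists V : seq (set K),
      [/\ (forall B, List.In B V -> mopen dK B),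
          (forall x, exists B, List.In B V /\ B x),
          (forall B, List.In B V -> exists2 A, List.In A U & B `<=` A) &
          (forall x, (count (fun B => `[< B x >]) V <= n.+1)%N)].

Definition covdim (K : Type) (dK : K -> K -> R) : \bar R :=
  ereal_inf [set (n%:R)%:E | n in [set n : nat | covdim_le dK n]].

Definition Wdim (X : Type) (rho : X -> X -> R) (eps : R) : \bar R :=
  ereal_inf [set D | exists (K : Type) (dK : K -> K -> R) (f : X -> K),
    [/\ is_metric dK, mcompact dK, mcontinuous rho dK f,
        (forall x y, f x = f y -> (rho x y < eps)%R) & D = covdim dK]].

Definition mdim_flow (X : Type) (d : X -> X -> R) (phi : X -> R -> X) : \bar R :=
  lim ((fun eps : R =>
          lim ((fun t : R => Wdim (dflow d phi t) eps * (t^-1)%:E)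
                 @ pinfty_nbhs R))
       @ (0%R)^'+).

End Defs.

(* Main.v *)
Require Import Defs.
From mathcomp Require Import all_boot all_order all_algebra.
From mathcomp Require Import all_classical all_reals all_analysis.
From mathcomp Require Import ring lra zify.
Set Implicit Arguments. Unset Strict Implicit. Unset Printing Implicit Defensive.
Import Order.TTheory GRing.Theory Num.Theory.
Local Open Scope classical_set_scope.

(** Following Lindenstrauss and Weiss: sample orbits at multiples of a short time
    [tau] and record, for each point of a finite net, a Lipschitz bump function
    around it.  This maps [X] into a cube [[0, 1]^M] with [M] of order [t].
    Choose a level [xi_c] for each coordinate [c] from a grid with [L ~ 1/delta]
    points.  A [d_t]-ball of radius [delta] comes near a given level in at most
    a fraction [1/L] of the choices, so if [X] is covered by [s] such balls and
    [s 2^M < L^(n+1)], some choice of levels leaves every point of [X] near its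
    levels in at most [n] coordinates.  Steepening each coordinate around its
    level then sends it to [0] or [1] except in those [n] places, so the image is
    a compact set of covering dimension at most [n], and the fibres are still
    [eps]-small.  Taking logarithms, [n] just above [t lower_mmdim] works
    for suitable small [delta] and all large [t]. *)

(** * Counting: a choice of levels with few hits *)

(* Averages the exponential moment [L ^ (number of hits)] over all [xi]. *)
Lemma exists_few_hits (J T : finType) (L n : nat) (bad : J -> T -> pred 'I_L) :
  (forall e k, #|bad e k| <= 1) -> #|J| * 2 ^ #|T| < L ^ n.+1 ->
  exists xi : {ffun T -> 'I_L}, forall e, #|[pred k | bad e k (xi k)]| <= n.
Proof.
move=> bad1 small.
have L0 : 0 < L by case: L bad bad1 small => // ? ? ; rewrite exp0n.
suff /existsP[xi /forallP xiP] : [exists xi : {ffun T -> 'I_L},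
    [forall e, #|[pred k | bad e k (xi k)]| <= n]] by exists xi.
apply: contraLR small; rewrite negb_exists => /forallP H.
rewrite -leqNgt -(leq_pmul2r (_ : 0 < L ^ #|T|)) ?expn_gt0 ?L0 //.
apply: (@leq_trans (\sum_(xi : {ffun T -> 'I_L}) \sum_(e : J)
          L ^ #|[pred k | bad e k (xi k)]|)).
  rewrite mulnC -[X in X ^ _ * _](card_ord L) -card_ffun -sum_nat_const.
  apply: leq_sum => xi _.
  have := H xi; rewrite negb_forall => /existsP[e]; rewrite -ltnNge => he.
  rewrite (bigD1 e) //=; apply: leq_trans (leq_addr _ _).
  exact: leq_pexp2l.
rewrite exchange_big /= -mulnA -sum_nat_const; apply: leq_sum => e _.
have -> : \sum_(xi : {ffun T -> 'I_L}) L ^ #|[pred k | bad e k (xi k)]| =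
  \prod_(k : T) \sum_(j < L) L ^ bad e k j.
  rewrite bigA_distr_bigA /=; apply: eq_bigr => xi _.
  by rewrite -expn_sum -sum1_card big_mkcond /=; congr (_ ^ _).
(* Each coordinate contributes at most [L + L]: at most one bad value, of weight [L], and at most
   [L] others, of weight 1. *)
rewrite -expnMn -prod_nat_const; apply: leq_prod => k _.
have -> : \sum_(j < L) L ^ bad e k j =
    \sum_(j < L | bad e k j) L + \sum_(j < L | ~~ bad e k j) 1.
  by rewrite (bigID (bad e k)) /=; congr (_ + _); apply: eq_bigr => j;
    [move=> ->; rewrite expn1|move=> /negbTE ->].
rewrite sum_nat_const sum1_card mul2n -addnn leq_add //.
  by rewrite -[leqRHS]mul1n leq_mul2r; apply/orP; right; exact: bad1.
by rewrite -[leqRHS](card_ord L) max_card.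
Qed.

Local Open Scope ring_scope.

Lemma In_mem (T : eqType) (x : T) (s : seq T) : List.In x s <-> x \in s.
Proof.
elim: s => // y s IH; rewrite inE /=; split.
  by case=> [->|/IH ->]; rewrite ?eqxx ?orbT.
by case/orP => [/eqP ->|/IH]; [left|right].
Qed.

(** * Compact metric spaces: finite nets, boundedness, Lebesgue numbers *)

Section Metric.
Context {R : realType} {X : Type} (d : X -> X -> R).
Hypotheses (dm : is_metric d) (dc : mcompact d).

Lemma mopen_ball (x : X) (r : R) : mopen d [set y | d x y < r].
Proof.
case: dm => _ _ _ dtri y /= xy; exists (r - d x y); first by rewrite subr_gt0.
by move=> z yz; have := dtri x y z; lra.
Qed.

(** Finitely many of the balls cover, and [l] is the least of their radii. The radius [r] is
    returned beside [l] because [Q] need not be monotone in it. *)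
Lemma uniform_radius (Q : X -> R -> Prop) :
  (forall x, exists2 r : R, 0 < r & Q x r) ->
  exists2 l : R, 0 < l & forall z, exists x r, [/\ l <= r, Q x r & d x z < r].
Proof.
move=> H.
pose I := {p : X * R | 0 < p.2 /\ Q p.1 p.2}.
have [||s sP] := dc (U := fun i : I => [set y | d (sval i).1 y < (sval i).2]).
- by move=> i; exact: mopen_ball.
- move=> x; have [r r0 Qxr] := H x.
  exists (exist _ (x, r) (conj r0 Qxr)) => /=.
  by case: dm => _ /(_ x x) [_ ->].
have [l l0 lP] : exists2 l : R, 0 < l & forall i, List.In i s -> l <= (sval i).2.
  elim: {sP} s => [|i s [l l0 lP]]; first by exists 1.
  exists (Num.min l (sval i).2); first by rewrite lt_min l0 (proj1 (svalP i)).
  move=> j [<-|js]; first by rewrite ge_min lexx orbT.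
  by rewrite ge_min lP.
exists l => // z; have [[[x r] [r0 Qxr]] /= [/lP /= lr xz]] := sP z.
by exists x, r.
Qed.

Lemma finite_net (r : R) : 0 < r ->
  exists s : seq X, forall x, exists i : 'I_(size s),
    d (tnth (in_tuple s) i) x < r.
Proof.
move=> r0; have [||s sP] := dc (U := fun p => [set y | d p y < r]).
- by move=> p; exact: mopen_ball.
- by move=> x; exists x => /=; case: dm => _ /(_ x x) [_ ->].
exists s => x; have [p [ps px]] := sP x.
elim: s {sP} ps => // q s IH /= [qp|/IH [i ix]].
  by exists ord0; rewrite (tnth_nth p) /= qp.
by exists (lift ord0 i); rewrite (tnth_nth p) /= -(tnth_nth p (in_tuple s)).
Qed.

(** Serves [dflow]: without an upper bound its supremum would be the default 0. *)
Lemma metric_bounded : exists M, forall x y, d x y <= M.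
Proof.
case: dm => d0 _ ds dt; have [s sP] := finite_net ltr01.
pose g (i j : 'I_(size s)) := d (tnth (in_tuple s) i) (tnth (in_tuple s) j).
exists (2 + \big[Num.max/0]_i \big[Num.max/0]_j g i j) => x y.
have [i xi] := sP x; have [j yj] := sP y.
have : g i j <= \big[Num.max/0]_i \big[Num.max/0]_j g i j.
  apply: le_trans (le_bigmax 0 (fun i => \big[Num.max/0]_j g i j) i).
  exact: (le_bigmax 0 (g i) j).
have := dt x (tnth (in_tuple s) i) y.
have := dt (tnth (in_tuple s) i) (tnth (in_tuple s) j) y.
by rewrite /g; have := ds x (tnth (in_tuple s) i); lra.
Qed.

Lemma lebesgue_number (U : seq (set X)) :
  (forall A, List.In A U -> mopen d A) ->
  (forall x, exists A, List.In A U /\ A x) ->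
  exists2 l : R, 0 < l & forall x, exists2 A, List.In A U &
    forall y, d x y < l -> A y.
Proof.
move=> Uo Uc; case: dm => _ _ _ dt.
(* With the doubled radius, a ball of radius [l <= r] about a point within [r] of [x] stays inside
   [A]. *)
have [|l l0 lP] := @uniform_radius (fun x r => exists2 A, List.In A U &
    forall y, d x y < r + r -> A y).
  move=> x; have [A [AU Ax]] := Uc x; have [r r0 rA] := Uo _ AU _ Ax.
  exists (r / 2); first by rewrite divr_gt0.
  by exists A => // y; rewrite -splitr; exact: rA.
exists l => // z; have [x [r [lr [A AU Ar] xz]]] := lP z.
by exists A => // y zy; apply: Ar; have := dt x z y; lra.
Qed.

End Metric.

(** * Covering dimension of a compact subset of the cube *)

Section Covdim.
Context {R : realType} {K : Type} (dK : K -> K -> R) (T : finType).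
Context (n : nat) (z : K -> T -> R).

(* The [n.+1] cut sets [{(a + (i + 1) / (n + 2)) / m}] are pairwise disjoint and
   lie inside the open unit interval, so a point with at most [n] coordinates
   in there misses one of them completely.  The pieces into which the [i]-th
   cut set divides the cube are disjoint, whence the multiplicity [n.+1]. *)
Let cut (i : 'I_n.+1) : R := i.+1%:R / n.+2%:R.

Let cut_itv i : 0 < cut i < 1.
Proof.
rewrite /cut divr_gt0 ?ltr0n // ltr_pdivrMr ?ltr0n // mul1r ltr_nat.
by have := ltn_ord i; lia.
Qed.

Let cut_inj i j : cut i - cut j \is a Num.int -> i = j.
Proof.
move=> /intrP[c cE]; have /andP[i0 i1] := cut_itv i; have /andP[j0 j1] := cut_itv j.
have /andP[? ?] : (-1 < c) && (c < 1) by rewrite -!(ltr_int R) -cE; lra.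
have c0 : c = 0 by lia.
move: cE; rewrite c0 => /eqP; rewrite subr_eq0 => /eqP /(divIf (_ : n.+2%:R != 0)).
rewrite pnatr_eq0 => /(_ isT) /eqP; rewrite eqr_nat => /eqP [] ij.
exact: val_inj.
Qed.

(** A cell between consecutive cuts. For [z] in the unit interval, [m * z - cut] lies in [(-1, m)],
    which the integers divide into [m.+1] intervals. *)
Let piece (m : nat) (p : 'I_n.+1 * {ffun T -> 'I_m.+1}) : set K :=
  [set x | forall k, (p.2 k)%:R - 1 < m%:R * z x k - cut p.1 < (p.2 k)%:R].

Lemma covdim_le_few_interior_coordinates (x0 : K) :
  is_metric dK -> mcompact dK ->
  (forall x y (e : R), 0 < e -> (forall k, `|z x k - z y k| < e) -> dK x y < e) ->
  (forall x y k, `|z x k - z y k| <= dK x y) ->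
  (forall x k, 0 <= z x k <= 1) ->
  (forall x, (#|[pred k | (0 < z x k < 1)%R]| <= n)%N) ->
  covdim_le dK n.
Proof.
move=> dm dc zd dz z01 zn U Uo Uc.
have [l l0 lP] := lebesgue_number dm dc Uo Uc.
have [m /andP[m0 ml]] : exists m : nat, (0 < m)%N && (m%:R^-1 <= l).
  exists (Num.truncn l^-1).+1 => /=; rewrite invf_ple ?posrE ?ltr0n //.
  by rewrite ltW // truncnS_gt.
have mR : 0 < m%:R :> R by rewrite ltr0n.
have pieceo p : mopen dK (piece (m := m) p).
  move=> x px.
  (* Distance, scaled by [m], to the nearer of the two faces bounding coordinate [k]. *)
  pose g k : R := Num.min (m%:R * z x k - cut p.1 - ((p.2 k)%:R - 1))
                      ((p.2 k)%:R - (m%:R * z x k - cut p.1)).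
  exists (\big[Num.min/1]_k g k / m%:R).
    rewrite divr_gt0 //; apply: lt_bigmin => // k _.
    by rewrite /g lt_min !subr_gt0; exact: px.
  move=> y xy k; have gk : m%:R * dK x y < g k.
    rewrite mulrC -ltr_pdivlMr //; apply: lt_le_trans xy _.
    by rewrite ler_pM2r ?invr_gt0 //; exact: bigmin_le_cond.
  have : `|m%:R * z x k - m%:R * z y k| < g k.
    apply: le_lt_trans gk; rewrite -mulrBr normrM (ger0_norm (ltW mR)).
    by rewrite ler_pM2l.
  by rewrite /g lt_min => /andP[]; rewrite !ltr_norml => /andP[? ?] /andP[? ?];
    apply/andP; split; lra.
exists [seq piece p | p <- enum [set: 'I_n.+1 * {ffun T -> 'I_m.+1}]%SET].
split.
- by move=> B /List.in_map_iff [p [<- _]].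
- move=> x.
  (* If every cut set met a coordinate of [x], picking one for each would be injective by [cut_inj].
     All [n.+1] picked coordinates would be interior, as the endpoints 0 and 1 lie on no cut. *)
  have [i iP] : exists i, forall k, m%:R * z x k - cut i \isn't a Num.int.
    apply: contrapT => /forallNP H.
    have {}H i : exists k, m%:R * z x k - cut i \is a Num.int.
      by have /existsNP[k /negP/negPn ?] := H i; exists k.
    pose h i := xchoose (H i); have hP i : m%:R * z x (h i) - cut i \is a Num.int.
      exact: (xchooseP (H i)).
    have : (#|[set: 'I_n.+1]%SET| <= n)%N.
      apply: leq_trans (zn x).
      have hinj : injective h.
        move=> i j hij; apply: cut_inj.
        have -> : cut i - cut j = (m%:R * z x (h j) - cut j) -
          (m%:R * z x (h i) - cut i) by rewrite hij; ring.
        exact: rpredB.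
      rewrite -(card_imset _ hinj); apply/subset_leq_card/fintype.subsetP => k.
      move=> /imsetP[i _ ->]; rewrite inE.
      have /andP[z0 z1] := z01 x (h i); have /andP[c0 c1] := cut_itv i.
      have /intrP[c cE] := hP i.
      apply/andP; split; rewrite lt_neqAle ?z0 ?z1 andbT; apply/eqP => hz.
        move: cE; rewrite -hz mulr0 sub0r => cE.
        have : (-1 < c) && (c < 0) by rewrite -!(ltr_int R) -cE; lra.
        lia.
      move: cE; rewrite hz mulr1 => cE.
      have : (m%:Z - 1 < c) && (c < m%:Z).
        by rewrite -!(ltr_int R) -cE intrB -pmulrn; lra.
      lia.
    by rewrite cardsT card_ord ltnn.
  (* No coordinate lies on the [i]-th cut set, so [floor + 1] labels the open interval containing
     it. *)
  pose fl k := absz (Num.floor (m%:R * z x k - cut i) + 1)%R.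
  have flP k : (fl k < m.+1)%N /\
      (fl k)%:R - 1 < m%:R * z x k - cut i < (fl k)%:R.
    have /andP[z0 z1] := z01 x k; have /andP[c0 c1] := cut_itv i.
    have mz0 : 0 <= m%:R * z x k by rewrite mulr_ge0.
    have mz1 : m%:R * z x k <= m%:R by rewrite ler_piMr.
    have := iP k; rewrite /fl; set y := _ - _; move=> yi.
    have /andP[f0 f1] := floor_itv y.
    have f2 : (Num.floor y)%:~R != y.
      by apply: contra yi => /eqP <-; exact: intr_int.
    have g0 : -1 <= Num.floor y by rewrite floor_ge_int /y; lra.
    have g1 : Num.floor y < m%:Z by rewrite floor_lt_int -pmulrn /y; lra.
    split; first by clear -g0 g1; lia.
    rewrite natr_absz ger0_norm; last by clear -g0; lia.
    by move: f0 f1; rewrite intrD le_eqVlt (negbTE f2) /=; lra.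
  exists (piece (i, [ffun k => Ordinal (flP k).1])); split.
    apply: List.in_map; apply/In_mem; by rewrite mem_enum inE.
  by move=> k; rewrite ffunE /=; have [] := flP k.
- move=> B /List.in_map_iff [p [<- _]].
  have [[x px]|/forallNP pn] := pselect (exists x, piece p x).
    have [A AU Al] := lP x; exists A => // y py; apply: Al; apply: zd => // k.
    have /andP[? ?] := px k; have /andP[? ?] := py k.
    apply: lt_le_trans ml; rewrite -(ltr_pM2l mR) mulfV ?gt_eqF //.
    rewrite -[X in X * _](ger0_norm (ltW mR)) -normrM mulrBr ltr_norml.
    by apply/andP; split; lra.
  (* An empty piece still needs a member of [U] around it. *)
  have [A [AU _]] := Uc x0.
  by exists A => // y /pn.
- move=> x; rewrite count_map -size_filter.
  set s := [seq _ <- _ | _].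
  have su : uniq s by rewrite filter_uniq // enum_uniq.
  rewrite -(card_uniqP su) -[leqRHS](card_ord n.+1).
  (* At most one piece per cut index contains [x]: open unit intervals with integer endpoints that
     share a point coincide. *)
  apply: (@leq_card_in _ _ fst) => -[i p] [j q] /=.
  rewrite !mem_filter /= => /andP[/asboolP ip _] /andP[/asboolP jq _] ij.
  move: jq; rewrite -{}ij => jq; congr (_, _); apply/ffunP => k.
  have le_of_itv (a b : nat) (y : R) : a%:R - 1 < y -> y < b%:R -> (a <= b)%N.
    by rewrite -ltnS -(ltr_nat R) -natr1; lra.
  have /andP[a1 a2] := ip k; have /andP[b1 b2] := jq k.
  apply/val_inj/eqP; rewrite eqn_leq.
  by rewrite (le_of_itv _ _ _ a1 b2) (le_of_itv _ _ _ b1 a2).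
Qed.

End Covdim.

(** * Truncation to the unit interval *)

Section Clamp.
Context {R : realType}.
Implicit Types u v : R.

Definition clamp u : R := Num.max 0 (Num.min 1 u).

Lemma clampP u : [\/ u <= 0 /\ clamp u = 0, 0 < u < 1 /\ clamp u = u |
  1 <= u /\ clamp u = 1].
Proof.
rewrite /clamp; case: (lerP u 0) => u0.
  by apply: Or31; split => //; rewrite min_r ?max_l //; lra.
case: (lerP 1 u) => u1; first by apply: Or33; split => //; rewrite max_r.
by apply: Or32; split => //; rewrite max_r // ltW.
Qed.

Lemma clamp_itv u : 0 <= clamp u <= 1.
Proof. by case: (clampP u) => -[? ->]; lra. Qed.

Lemma clamp_ge1 u : 1 <= u -> clamp u = 1.
Proof. by case: (clampP u) => -[? ->]; lra. Qed.

Lemma clamp_le0 u : u <= 0 -> clamp u = 0.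
Proof. by case: (clampP u) => -[? ->]; lra. Qed.

Lemma clamp_interior u : 0 < clamp u < 1 -> 0 < u < 1.
Proof. by case: (clampP u) => -[? ->]; lra. Qed.

Lemma clamp_lipschitz u v : `|clamp u - clamp v| <= `|u - v|.
Proof.
have := ler_norm (u - v); have := ler_norm (v - u); rewrite distrC ler_norml.
by case: (clampP u) => -[? ->]; case: (clampP v) => -[? ->]; lra.
Qed.

End Clamp.

(** * Common radii and images of compact spaces *)

Lemma exists_common_radius {R : realType} (I : finType) (P : I -> R -> Prop) :
  (forall i, exists2 r : R, 0 < r & forall s, s <= r -> P i s) ->
  exists2 r : R, 0 < r & forall i, P i r.
Proof.
move=> H; have /choice[g gP] : forall i, exists r : R,
    0 < r /\ forall s, s <= r -> P i s by move=> i; have [r ? ?] := H i; exists r.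
exists (\big[Num.min/1]_i g i); first by apply: lt_bigmin => // i _; have [] := gP i.
by move=> i; apply: (gP i).2; exact: bigmin_le_cond.
Qed.

Lemma mcompact_surjective_image {R : realType} (X Y : Type) (dX : X -> X -> R)
  (dY : Y -> Y -> R) (g : X -> Y) :
  mcompact dX -> mcontinuous dX dY g -> (forall y, exists x, g x = y) ->
  mcompact dY.
Proof.
move=> cX gc gs I U Uo Uc.
have [||s sP] := cX I (fun i => [set x | U i (g x)]).
- move=> i x Uix; have [e e0 eU] := Uo i _ Uix.
  by have [r r0 rP] := gc x e e0; exists r => // y /rP /eU.
- by move=> x; have [i] := Uc (g x); exists i.
by exists s => y; have [x <-] := gs y; exact: sP.
Qed.

(** * The map to the cube and the bound on [Wdim] *)

Section Flow.
Context {R : realType} {X : Type} (d : X -> X -> R) (phi : X -> R -> X).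
Hypotheses (dm : is_metric d) (dc : mcompact d) (df : is_flow d phi).

Lemma flow_small_time (e : R) : 0 < e ->
  exists2 tau : R, 0 < tau & forall x s, `|s| < tau -> d x (phi x s) < e.
Proof.
case: dm => _ _ ds dt; case: df => phic phi0 _ e0.
(* The clause [r <= e / 2] bounds [d x z], the other half of the final triangle inequality. *)
have [|l l0 lP] := @uniform_radius _ _ _ dm dc (fun x r => r <= e / 2 /\
    forall y s, d x y < r -> `|s| < r -> d x (phi y s) < e / 2).
  move=> x; have [|r r0 rP] := phic x 0 (e / 2); first lra.
  exists (Num.min r (e / 2)); first by rewrite lt_min r0; lra.
  split=> [|y s]; first by rewrite ge_min lexx orbT.
  rewrite !lt_min => /andP[xy _] /andP[sr _].
  by rewrite -{1}(phi0 x); apply: rP => //; rewrite sub0r normrN.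
exists l => // z s sl; have [x [r [lr [re rP] xz]]] := lP z.
have := rP z s xz (lt_le_trans sl lr); have := dt z x (phi z s); rewrite (ds z x).
lra.
Qed.

Lemma le_dflow (t s : R) x y : 0 <= s <= t ->
  d (phi x s) (phi y s) <= dflow d phi t x y.
Proof.
move=> st; have [M MP] := metric_bounded dm dc.
apply: ub_le_sup; first by exists M => _ [u _ <-].
by exists s => //=; rewrite in_itv.
Qed.

Lemma dflow_le (t c : R) x y : 0 <= t ->
  (forall s, 0 <= s <= t -> d (phi x s) (phi y s) <= c) ->
  dflow d phi t x y <= c.
Proof.
move=> t0 H; apply: ge_sup; last by move=> _ [s /= + <-]; rewrite in_itv; exact: H.
by exists (d (phi x 0) (phi y 0)), 0 => //=; rewrite in_itv /= lexx.
Qed.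

(** The construction at fixed scales: [p] is a [rho]-net, [tau] the sampling step, [N] the number of
    sample times, [L] the number of levels, [E] a [delta]-spanning set. There are [r * N]
    coordinates. *)
Lemma Wdim_dflow_le (x0 : X) (t eps delta rho tau : R) (r L n s : nat)
    (p : 'I_r -> X) (E : 'I_s -> X) :
  let N := (Num.truncn (t / tau)).+1 in
  0 <= t -> 0 < rho -> 12 * rho <= eps -> 0 < tau -> (0 < L)%N ->
  4 * L%:R * delta <= rho ->
  (forall x u, `|u| < tau -> d x (phi x u) < eps / 4) ->
  (forall x, exists i, d (p i) x < rho) ->
  (forall x, exists j, dflow d phi t x (E j) < delta) ->
  (s * 2 ^ (r * N) < L ^ n.+1)%N ->
  (Wdim (dflow d phi t) eps <= n%:R%:E)%E.
Proof.
move=> N t0 rho0 rhoe tau0 L0 Ld small net span count.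
case: (dm) => d0 dP ds dt; case: (df) => phic phi0 phiD.
have LR : 0 < L%:R :> R by rewrite ltr0n.
pose T : finType := ('I_r * 'I_N)%type.
pose orb x (k : 'I_N) := phi x (k%:R * tau).
(* A bump: 1 within [rho] of the net point, 0 beyond [2 * rho]. *)
pose w (x : X) (c : T) := clamp (2 - d (p c.1) (orb x c.2) / rho).
have time_itv (k : 'I_N) : 0 <= k%:R * tau <= t.
  rewrite mulr_ge0 ?ler0n ?(ltW tau0) //= -ler_pdivlMr //.
  have tt : 0 <= t / tau by rewrite divr_ge0 // ltW.
  apply: le_trans (_ : (Num.truncn (t / tau))%:R <= _).
    by rewrite ler_nat -ltnS ltn_ord.
  by rewrite truncn_le.
have w_lip x y c : `|w x c - w y c| <= d (orb x c.2) (orb y c.2) / rho.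
  apply: le_trans (clamp_lipschitz _ _) _.
  have -> : 2 - d (p c.1) (orb x c.2) / rho - (2 - d (p c.1) (orb y c.2) / rho) =
     (d (p c.1) (orb y c.2) - d (p c.1) (orb x c.2)) / rho by field; rewrite gt_eqF.
  rewrite normrM [X in _ * X]gtr0_norm ?invr_gt0 // ler_pM2r ?invr_gt0 //.
  have := dt (p c.1) (orb x c.2) (orb y c.2).
  have := dt (p c.1) (orb y c.2) (orb x c.2).
  by rewrite (ds (orb y c.2)) ler_norml; lra.
(* Bad means [w] in [(j / L, (j + 1) / L)]; these intervals are disjoint in [j]. *)
pose bad (e : 'I_s) (c : T) (j : 'I_L) :=
  `|2 * L%:R * w (E e) c - (2 * j%:R + 1)| < 1.
have [xi xiP] : exists xi : {ffun T -> 'I_L},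
    forall e, (#|[pred c | bad e c (xi c)]| <= n)%N.
  apply: exists_few_hits; last by rewrite card_prod !card_ord.
  move=> e c; apply/card_le1_eqP => i j; rewrite -!topredE /= /bad !ltr_norml => bi bj.
  apply/val_inj/eqP; rewrite eqn_leq.
  by apply/andP; split; rewrite -ltnS -(ltr_nat R) -natr1 /=; lra.
(* A ramp over the middle half of the chosen interval. The margin [1 / (4 L)] on each side is the
   most that [w] can change between [x] and a spanning point. *)
pose f (x : X) : {ffun T -> R} :=
  [ffun c => clamp (2 * L%:R * w x c - 2 * (xi c)%:R - 1 / 2)].
have f_lip x y c : `|f x c - f y c| <= 2 * L%:R / rho * d (orb x c.2) (orb y c.2).
  rewrite !ffunE; apply: le_trans (clamp_lipschitz _ _) _.
  have -> : 2 * L%:R * w x c - 2 * (xi c)%:R - 1 / 2 -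
    (2 * L%:R * w y c - 2 * (xi c)%:R - 1 / 2) = 2 * L%:R * (w x c - w y c) by ring.
  rewrite normrM ger0_norm; last by rewrite mulr_ge0 // ltW.
  rewrite -!mulrA ler_pM2l // ler_pM2l // mulrC.
  exact: w_lip.
pose K := set_type (range f).
pose z (a : K) (c : T) : R := (sval a : {ffun T -> R}) c.
pose dK (a b : K) : R := \big[Num.max/0]_(c : T) `|z a c - z b c|.
have le_dK a b c : `|z a c - z b c| <= dK a b.
  exact: (le_bigmax 0 (fun c => `|z a c - z b c|) c).
have dK_lt a b (e : R) : 0 < e -> (forall c, `|z a c - z b c| < e) -> dK a b < e.
  by move=> e0 H; apply: bigmax_lt.
have dK_le a b (e : R) : 0 <= e -> (forall c, `|z a c - z b c| <= e) -> dK a b <= e.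
  by move=> e0 H; apply: bigmax_le.
have dK0 a b : 0 <= dK a b by exact: bigmax_ge_id.
have dKm : is_metric dK.
  split=> //.
  - move=> a b; split=> [ab|->].
      apply/val_inj/ffunP => c; apply/eqP; rewrite -subr_eq0 -normr_le0 -ab.
      exact: le_dK.
    by apply/le_anti; rewrite dK0 andbT; apply: dK_le => // c; rewrite subrr normr0.
  - by move=> a b; apply: eq_bigr => c _; rewrite distrC.
  - move=> a b c; apply: dK_le; first by rewrite addr_ge0.
    move=> k; apply: le_trans (lerD (le_dK a b k) (le_dK b c k)).
    exact: ler_distD.
have fK x : f x \in range f by rewrite inE; exists x.
pose g x : K := SigSub (fK x).
pose C := 2 * L%:R / rho.
have C0 : 0 < C by rewrite /C divr_gt0 // mulr_gt0.
(* Continuity for [d] makes [K] compact; continuity for [dflow], shown next, is what [Wdim] asks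
   for. *)
have gd : mcontinuous d dK g.
  move=> x e e0.
  have [k|q q0 qP] := @exists_common_radius R _ (fun (k : 'I_N) q =>
      forall y, d x y < q -> d (orb x k) (orb y k) < e / C).
    have [|q q0 qP] := phic x (k%:R * tau) (e / C); first by rewrite divr_gt0.
    exists q => // u uq y xy; apply: qP; first exact: lt_le_trans xy uq.
    by rewrite subrr normr0.
  exists q => // y xy; apply: dK_lt => // c; apply: le_lt_trans (f_lip x y c) _.
  by rewrite -/C mulrC -ltr_pdivlMr //; exact: qP.
have gt : mcontinuous (dflow d phi t) dK g.
  move=> x e e0; exists (e / C); first by rewrite divr_gt0.
  move=> y xy; apply: dK_lt => // c; apply: le_lt_trans (f_lip x y c) _.
  rewrite -/C mulrC -ltr_pdivlMr //; apply: le_lt_trans xy.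
  exact: le_dflow.
have gsurj a : exists x, g x = a.
  have [x _ xa] := set_valP a; exists x; exact: val_inj.
have gsep x y : g x = g y -> dflow d phi t x y < eps.
  move=> gxy; have fxy c : f x c = f y c by have := congr1 sval gxy => /= ->.
  (* A supremum loses strictness, hence the slack. Moving both orbits to a sample time costs
     [eps / 4] each, and the passage through a net point [3 * rho <= eps / 4]. *)
  apply: (@le_lt_trans _ _ (3 / 4 * eps)); last lra.
  apply: dflow_le => // u /andP[u0 ut].
  have ut0 : 0 <= u / tau by rewrite divr_ge0 // ltW.
  have kN : (Num.truncn (u / tau) < N)%N.
    by rewrite ltnS le_truncn // ler_pM2r ?invr_gt0.
  pose k : 'I_N := Ordinal kN.
  have [i ix] := net (orb x k).
  have wx : w x (i, k) = 1.
    rewrite /w /= clamp_ge1 //.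
    have : d (p i) (orb x k) / rho < 1 by rewrite ltr_pdivrMr // mul1r.
    lra.
  (* The ramp lies strictly between 0 and 1, since [xi <= L - 1], so steepening preserves the bump
     values 0 and 1. *)
  have xiL : (xi (i, k))%:R + 1 <= L%:R :> R by rewrite natr1 ler_nat ltn_ord.
  have fx : f x (i, k) = 1 by rewrite ffunE wx clamp_ge1 //; lra.
  have iy : d (p i) (orb y k) < 2 * rho.
    rewrite ltNge; apply/negP => iy.
    have wy : w y (i, k) = 0.
      rewrite /w /= clamp_le0 //.
      have : 2 <= d (p i) (orb y k) / rho by rewrite ler_pdivlMr.
      lra.
    have : f y (i, k) = 0.
      by rewrite ffunE wy clamp_le0 //; have := ler0n R (xi (i, k)); lra.
    by rewrite -fxy fx => /eqP; rewrite oner_eq0.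
  pose v := u - k%:R * tau.
  have vt : `|v| < tau.
    have := truncn_itv ut0 => /andP[]; rewrite ler_pdivlMr // ltr_pdivrMr //.
    rewrite -natr1 mulrDl mul1r => k1 k2.
    by rewrite ger0_norm /v /=; lra.
  have orbu q : phi q u = phi (orb q k) v by rewrite /orb -phiD /v subrK.
  rewrite !orbu.
  have := small (orb x k) v vt; have := small (orb y k) v vt.
  have := dt (phi (orb x k) v) (orb x k) (phi (orb y k) v).
  have := dt (orb x k) (orb y k) (phi (orb y k) v).
  have := dt (orb x k) (p i) (orb y k).
  rewrite (ds (orb x k) (p i)) (ds (phi (orb x k) v) (orb x k)); lra.
have Kc : mcompact dK by exact: mcompact_surjective_image gd gsurj.
apply: (@le_trans _ _ (covdim dK)).
  by apply: ereal_inf_lbound; exists K, dK, g.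
apply: ereal_inf_lbound; exists n => //=.
apply: (@covdim_le_few_interior_coordinates _ _ _ T n z (g x0)) => //.
  by move=> a c; have [x <-] := gsurj a; rewrite /z ffunE; exact: clamp_itv.
move=> a; have [x <-] := gsurj a; have [e xe] := span x.
(* At an interior coordinate, [2 L w] is within 1/2 of the centre [2 xi + 1]. Passing to [E e] moves
   it by at most 1/2 more, so the coordinate is a hit for [e]. *)
apply: leq_trans (xiP e); apply/subset_leq_card/fintype.subsetP => c.
rewrite !inE /z /= ffunE => /clamp_interior intr.
have := le_trans (w_lip x (E e) c) (_ : _ <= delta / rho).
rewrite ler_pM2r ?invr_gt0 // => /(_ (le_trans (le_dflow _ _ (time_itv _)) (ltW xe))).
rewrite -(@ler_pM2l _ (2 * L%:R)) ?mulr_gt0 // => le2.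
have le1 : 2 * L%:R * (delta / rho) <= 1 / 2.
  by rewrite mulrA ler_pdivrMr //; lra.
have := le_trans le2 le1.
rewrite /bad -[X in X * `|_|]ger0_norm; last by rewrite mulr_ge0 // ltW.
by rewrite -normrM ler_norml ltr_norml mulrBr; lra.
Qed.

End Flow.

(** * Upper and lower limits along a filter *)

Section LimSupInf.
Context {R : realType} (T : choiceType) (X : filteredType T).
Context (F : set_system X) {FF : ProperFilter F}.
Implicit Types (f : X -> \bar R) (a : \bar R).
Local Open Scope ereal_scope.

(** Two members of a proper filter share a point, whose value lies between the infimum over one and
    the supremum over the other. *)
Lemma limf_einf_le_esup f : limf_einf f F <= limf_esup f F.
Proof.
rewrite limf_einfE limf_esupE; apply: ge_ereal_sup => _ [V FV <-].
apply: le_ereal_inf_tmp => _ [W FW <-].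
have [x [Vx Wx]] := filter_ex (filterI FV FW).
apply: (@le_trans _ _ (f x)); first by apply: ereal_inf_lbound; exists x.
by apply: ereal_sup_ubound; exists x.
Qed.

Lemma limf_esup_lt_near f a : limf_esup f F < a -> \forall x \near F, f x < a.
Proof.
rewrite limf_esupE => /ereal_inf_lt[_ [V FV <-] Va].
apply: filterS FV => x Vx; apply: le_lt_trans Va.
by apply: ereal_sup_ubound; exists x.
Qed.

Lemma limf_einf_lt_frequently f a (V : set X) : limf_einf f F < a -> F V ->
  exists2 x, V x & f x < a.
Proof.
rewrite limf_einfE => fa FV.
have /ereal_inf_lt[_ [x Vx <-] xa] : ereal_inf (f @` V) < a.
  by apply: le_lt_trans fa; apply: ereal_sup_ubound; exists V.
by exists x.
Qed.

Lemma near_ge_limf_einf f a : (\forall x \near F, a <= f x) -> a <= limf_einf f F.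
Proof.
rewrite limf_einfE => FV.
apply: (@le_trans _ _ (ereal_inf (f @` [set x | a <= f x]))).
  by apply: le_ereal_inf_tmp => _ [x ax <-].
by apply: ereal_sup_ubound; exists [set x | a <= f x].
Qed.

End LimSupInf.

(* A limit that does not exist is [point], which is [0] in [\bar R]. *)
Lemma lim_le_of_ge0 {R : realType} {T : Type} {F : set_system T}
    {FF : ProperFilter F} (f : T -> \bar R) (a : \bar R) :
  (0 <= a)%E -> (\forall x \near F, (f x <= a)%E) -> (lim (f @ F) <= a)%E.
Proof.
move=> a0 fa; have [cf|/dvgP -> //] := pselect (cvg (f @ F)).
exact: lime_le.
Qed.

(** * Asymptotics in [t] and [delta] *)

Section MeanDim.
Context {R : realType} {X : Type} (d : X -> X -> R) (phi : X -> R -> X).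
Hypotheses (dm : is_metric d) (dc : mcompact d) (df : is_flow d phi).
Variable x0 : X.

Lemma span_num_ge1 (t eps : R) : (1 <= span_num d phi setT t eps)%E.
Proof.
apply: le_ereal_inf_tmp => _ [n [E EP] <-].
have [j _] := EP x0 I; rewrite lee_fin (ler_nat R 1 n).
exact: leq_trans (ltn_ord j).
Qed.

Lemma span_rate_ge0 (eps : R) : (0 <= span_rate d phi setT eps)%E.
Proof.
apply: le_trans (limf_einf_le_esup _); apply: near_ge_limf_einf.
near=> t; apply: mule_ge0.
  by rewrite lee_fin invr_ge0; near: t; exact: nbhs_pinfty_ge.
have s1 := span_num_ge1 t eps.
rewrite -lne1 lee_lne // in_itv /= leey andbT ?lee01 //.
exact: le_trans s1.
Unshelve. all: by end_near. Qed.

Lemma lower_mmdim_ge0 : (0 <= lower_mmdim d phi)%E.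
Proof.
apply: near_ge_limf_einf; near=> eps.
have eps0 : 0 < eps by near: eps; exact: nbhs_right_gt.
have eps1 : eps <= 1 by near: eps; exact: nbhs_right_le.
apply: mule_ge0; first exact: span_rate_ge0.
by rewrite lee_fin invr_ge0 ln_ge0 // invf_ge1.
Unshelve. all: by end_near. Qed.

(** Logarithm of the counting hypothesis, per unit time: [(D + eta) * l] from the spanning set plus
    a constant for [2 ^ (r * N)] must not exceed [(D + 2 * eta) * (l - c)], where [l = ln delta^-1].
    The surplus [eta * l] wins for small [delta]. *)
Lemma Wdim_dflow_growth (D eps eta : R) : 0 < eps -> 0 < eta ->
  lower_mmdim d phi = D%:E ->
  \forall t \near +oo,
    (Wdim (dflow d phi t) eps * (t^-1)%:E <= (D + 2 * eta)%:E)%E.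
Proof.
move=> eps0 eta0 DE.
have D0 : 0 <= D by rewrite -lee_fin -DE lower_mmdim_ge0.
have [|tau tau0 small] := flow_small_time dm dc df (_ : 0 < eps / 4); first lra.
pose rho := eps / 12; have rho0 : 0 < rho by rewrite /rho; lra.
have [net netP] := finite_net dm dc rho0; pose r := size net.
(* After rounding, [L >= rho / (8 * delta)], so [ln L >= l - c]. Once [l >= B], the surplus covers
   all constants; these depend on [eps], [eta] and [D] but not on [delta], which is chosen
   afterwards. *)
pose c := ln (8 / rho).
pose B := ((D + 2 * eta) * c + 2 * r%:R * ln 2 / tau) / eta.
pose V : set R := [set u | [/\ 0 < u, u < 1, u < rho / 4 & u < expR (- B)]].
have FV : (0 : R)^'+ V.
  near=> u; split; near: u.
  - exact: nbhs_right_gt.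
  - exact: nbhs_right_lt.
  - by apply: nbhs_right_lt; lra.
  - by apply: nbhs_right_lt; exact: expR_gt0.
have : (lower_mmdim d phi < (D + eta)%:E)%E by rewrite DE lte_fin; lra.
rewrite /lower_mmdim => /limf_einf_lt_frequently /(_ FV).
case=> delta [dl0 dl1 dlr dlB] rate.
pose l := ln delta^-1.
have l0 : 0 < l by rewrite /l ln_gt0 // invf_gt1.
have lB : (D + 2 * eta) * c + 2 * r%:R * ln 2 / tau <= eta * l.
  rewrite [leRHS]mulrC -ler_pdivrMr // -/B /l lnV ?posrE // lerNr.
  by rewrite -[leRHS]expRK ler_ln ?posrE ?expR_gt0 // ltW.
pose L := Num.truncn (rho / (4 * delta)).
have q1 : 1 <= rho / (4 * delta).
  by rewrite ler_pdivlMr ?mulr_gt0 // mul1r; lra.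
have L0 : (0 < L)%N by rewrite truncn_gt0.
have LR : 1 <= L%:R :> R by rewrite ler1n.
have /andP[Lle Lgt] : (L%:R <= rho / (4 * delta) < L.+1%:R).
  by apply: truncn_itv; lra.
have lnL : l - c <= ln L%:R.
  have -> : l - c = ln (rho / (8 * delta)).
    rewrite /l /c -ln_div ?posrE ?invr_gt0 ?divr_gt0 //; congr ln.
    by field; rewrite !gt_eqF.
  rewrite ler_ln ?posrE ?divr_gt0 ?mulr_gt0 ?ltr0n //.
  have -> : rho / (8 * delta) = rho / (4 * delta) / 2 by field; rewrite gt_eqF.
  by move: Lgt; rewrite -natr1; lra.
have /limf_esup_lt_near rate_t :
    (span_rate d phi setT delta < ((D + eta) * l)%:E)%E.
  by rewrite EFinM -lte_pdivrMr.
near=> t.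
have t0 : 0 < t by near: t; apply: nbhs_pinfty_gt; exact: num_real.
have ttau : tau <= t by near: t; apply: nbhs_pinfty_ge; exact: num_real.
have : ((t^-1)%:E * lne (span_num d phi setT t delta) < ((D + eta) * l)%:E)%E.
  by near: t.
rewrite muleC lte_pdivrMr // -EFinM -lte_expeR lneK; last first.
  by rewrite in_itv /= leey andbT (le_trans _ (span_num_ge1 t delta)).
move=> /ereal_inf_lt[_ [s [E EP] <-]] /=; rewrite lte_fin => s_lt.
(* Rounding down serves both ends: [n] bounds the dimension, while the exponent [n.+1] in the count
   exceeds [(D + 2 * eta) * t]. *)
pose n := Num.truncn ((D + 2 * eta) * t).
have Dt0 : 0 <= (D + 2 * eta) * t by rewrite mulr_ge0 // ?ltW //; lra.
have /andP[nle ngt] := truncn_itv Dt0.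
rewrite lee_pdivrMr // -EFinM; apply: (@le_trans _ _ n%:R%:E); last first.
  by rewrite lee_fin.
apply: (@Wdim_dflow_le _ _ _ _ dm dc df x0 t eps delta rho tau r L n s
   (tnth (in_tuple net)) E) => //.
- by rewrite /rho; lra.
- by move: Lle; rewrite ler_pdivlMr ?mulr_gt0 //; lra.
- by move=> x; exact: EP.
set N := (Num.truncn _).+1.
have NR : N%:R <= 2 * t / tau.
  rewrite /N -natr1.
  have : (Num.truncn (t / tau))%:R <= t / tau by rewrite truncn_le divr_ge0 // ltW.
  have : 1 <= t / tau by rewrite ler_pdivlMr // mul1r.
  by rewrite -mulrA; lra.
rewrite -(ltr_nat R) natrM !natrX.
have two_exp : 2 = expR (ln 2) :> R by rewrite lnK // posrE.
have L_exp : L%:R = expR (ln L%:R) :> R by rewrite lnK // posrE ltr0n.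
rewrite L_exp {1}two_exp -!expRM_natl.
apply: (@lt_le_trans _ _ (expR ((D + eta) * l * t) * expR ((r * N)%:R * ln 2))).
  by rewrite ltr_pM2r ?expR_gt0.
rewrite -expRD ler_expR.
have ln20 : 0 <= ln 2 :> R by rewrite ln_ge0 // ler1n.
have h1 : (r * N)%:R * ln 2 <= 2 * r%:R * ln 2 / tau * t.
  rewrite natrM.
  have -> : 2 * r%:R * ln 2 / tau * t = r%:R * (2 * t / tau) * ln 2 by ring.
  by rewrite ler_wpM2r // ler_wpM2l.
have h2 : (D + 2 * eta) * t * (l - c) <= n.+1%:R * ln L%:R.
  apply: (@le_trans _ _ ((D + 2 * eta) * t * ln L%:R)).
    by rewrite ler_wpM2l.
  by rewrite ler_wpM2r ?ln_ge0 // ltW.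
apply: le_trans h2.
have := lB; rewrite -(ler_pM2r t0) => lBt.
apply: (@le_trans _ _ ((D + eta) * l * t + 2 * r%:R * ln 2 / tau * t)).
  by rewrite lerD2l.
lra.
Unshelve. all: by end_near. Qed.

Lemma mdim_flow_le_lower_mmdim : (mdim_flow d phi <= lower_mmdim d phi)%E.
Proof.
have := lower_mmdim_ge0; case DE: (lower_mmdim d phi) => [D| |] // D0; last first.
  by rewrite leey.
apply: lim_le_of_ge0 => //; near=> eps.
have eps0 : 0 < eps by near: eps; exact: nbhs_right_gt.
apply/lee_addgt0Pr => eta eta0; apply: lim_le_of_ge0.
  by rewrite adde_ge0 // lee_fin ltW.
have := @Wdim_dflow_growth D eps (eta / 2) eps0 _ DE.
have -> : D + 2 * (eta / 2) = D + eta by field.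
by apply; rewrite divr_gt0.
Unshelve. all: by end_near. Qed.

End MeanDim.

Theorem theorem1p1 (R : realType) (X : Type) (d : X -> X -> R)
  (phi : X -> R -> X) :
  is_metric d -> mcompact d -> (exists x : X, True) -> is_flow d phi ->
  (mdim_flow d phi <= lower_mmdim d phi <= upper_mmdim d phi)%E.
Proof.
move=> dm dc [x0 _] df; apply/andP; split.
  exact: (mdim_flow_le_lower_mmdim dm dc df x0).
exact: limf_einf_le_esup.
Qed.
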